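(* Let $X=(x(1),\dots,x(m))\in[n]^m$ be any access sequence, and for $x\in[n]$ let $\mathbf{f}_x=|\{i\in[m]: x(i)=x\}|$ be the frequency of $x$, where every item is accessed at least once ($\mathbf{f}_x\ge 1$). For each item $x\in[n]$ set $$\mathrm{pri}_x := -\left\lfloor \log_2\log_2 \frac{m}{\mathbf{f}_x}\right\rfloor + \delta_x,\qquad \delta_x\sim U(0,1).$$ In the Treap on $[n]$ with these priorities, each node $x$ has expected depth $O(\log(m/\mathbf{f}_x))$. Consequently, the expected total time for processing the access sequence (where accessing $x$ costs its depth) is $O\left(\sum_x \mathbf{f}_x\log(m/\mathbf{f}_x)\right)$, which matches the cost of the optimal static binary search tree up to a constant factor.
   Context: A Treap on $[n]$ with distinct priorities $\mathrm{pri}$ is the unique binary search tree on keys $[n]$ in which every node's priority is at least the priorities of its descendants. Depth of a node = number of its ancestors including itself. The cost of the optimal static BST for the access sequence is $\Theta(\sum_x \mathbf{f}_x\log(m/\mathbf{f}_x))$. The random offsets $\delta_x$ are uniform on $(0,1)$ (drawn via an $11$-wise independent hash function, as for Score-Respecting Treaps).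
   Formalization: Since depth counts the node itself and log(m/f_x) can tend to 0, the bounds are proved as expected depth ≤ 1 + C log(m/f_x) and expected total time ≤ m + C Σ f_x log(m/f_x); the optimal static tree's cost is likewise compared with m + Σ f_x log(m/f_x). *)

(* Defs.v *)
From HB Require Import structures.
From mathcomp Require Import all_boot all_order all_algebra.
From mathcomp Require Import all_classical all_reals all_analysis.

Set Implicit Arguments.
Unset Strict Implicit.
Unset Printing Implicit Defensive.

Import Order.TTheory GRing.Theory Num.Theory.

Local Open Scope classical_set_scope.
Local Open Scope ring_scope.

(* Binary trees whose nodes carry keys in [n], represented by 'I_n. *)
Inductive tree (n : nat) : Type :=
  | Leaf
  | Node of tree n & 'I_n & tree n.

Arguments Leaf {n}.

HB.instance Definition _ n := gen_eqMixin (tree n).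
HB.instance Definition _ n := gen_choiceMixin (tree n).

Fixpoint keys n (t : tree n) : seq 'I_n :=
  if t is Node l x r then keys l ++ x :: keys r else [::].

Fixpoint search_ordered n (t : tree n) : bool :=
  if t is Node l x r then
    [&& all (fun y : 'I_n => (y < x)%N) (keys l),
        all (fun y : 'I_n => (x < y)%N) (keys r),
        search_ordered l & search_ordered r]
  else true.

(* A binary search tree on the whole key set [n]; search_ordered already
   rules out repeated keys. *)
Definition is_bst n (t : tree n) : Prop :=
  search_ordered t /\ forall x : 'I_n, x \in keys t.

(* y labels a node whose subtree contains the key x; every node of the tree is
   an ancestor of itself. *)
Fixpoint ancestor n (t : tree n) (y x : 'I_n) : bool :=
  if t is Node l z r then
    [|| (y == z) && (x \in keys (Node l z r)), ancestor l y x | ancestor r y x]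
  else false.

Definition depth n (t : tree n) (x : 'I_n) : nat :=
  #|[set y : 'I_n | ancestor t y x]|%SET.

Definition is_treap (R : realType) n (pri : 'I_n -> R) (t : tree n) : Prop :=
  is_bst t /\ forall x y : 'I_n, ancestor t y x -> pri x <= pri y.

(* The treap with priorities pri; see treap_is_treap and treap_unique. If two
   priorities coincide this is some tree satisfying is_treap. *)
Definition treap (R : realType) n (pri : 'I_n -> R) : tree n :=
  xget Leaf [set t | is_treap pri t].

Definition access_cost n m (t : tree n) (X : m.-tuple 'I_n) : nat :=
  (\sum_(i < m) depth t (tnth X i))%N.

Definition is_optimal_bst n m (X : m.-tuple 'I_n) (t : tree n) : Prop :=
  is_bst t /\ forall t', is_bst t' -> (access_cost t X <= access_cost t' X)%N.

Definition freq n m (X : m.-tuple 'I_n) (x : 'I_n) : nat :=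
  #|[set i : 'I_m | tnth X i == x]|%SET.

Definition log2 (R : realType) (x : R) : R := ln x / ln 2.

(* Outside its intended domain, ln is 0; here this only concerns n = 1, where
   m / freq = 1 and the (unique) treap does not depend on the priority. *)
Definition priority (R : realType) n m (X : m.-tuple 'I_n) (delta : 'I_n -> R)
    (x : 'I_n) : R :=
  - (Num.floor (log2 (log2 (m%:R / (freq X x)%:R : R))))%:~R + delta x.

(* k-wise independence: any at most k of the variables Y i are mutually
   independent. *)
Definition kwise_independent d (Omega : measurableType d) (R : realType)
    (P : probability Omega R) (I : finType) (k : nat)
    (Y : I -> {RV P >-> R}) : Prop :=
  forall (S : {set I}) (B : I -> set R),
    (#|S| <= k)%N -> (forall i, measurable (B i)) ->
    P (\bigcap_(i in [set` S]) (Y i @^-1` B i)) =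
    (\prod_(i in S) P (Y i @^-1` B i))%E.

(* uniform_prob is normalised Lebesgue measure on `[0, 1], which is also the
   uniform law on `]0, 1[. *)
Definition uniform01 d (Omega : measurableType d) (R : realType)
    (P : probability Omega R) (Y : {RV P >-> R}) : Prop :=
  forall B : set R, measurable B ->
    distribution P Y B = uniform_prob (@ltr01 R) B.

Lemma ancestor_key n (t : tree n) y x :
  ancestor t y x -> (y \in keys t) && (x \in keys t).
Proof.
elim: t => [//|l IHl z r IHr] /= /or3P[/andP[/eqP -> ->]|/IHl|/IHr].
- by rewrite mem_cat inE eqxx orbT.
- by case/andP=> yl xl; rewrite !mem_cat yl xl.
- by case/andP=> yl xl; rewrite !mem_cat !inE yl xl !orbT.
Qed.

Lemma treap_on (R : realType) n (pri : 'I_n -> R) (A : {set 'I_n}) :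
  exists t : tree n, [/\ search_ordered t, keys t =i A &
    forall x y, ancestor t y x -> pri x <= pri y].
Proof.
have [k] := ubnP #|A|; elim: k A => // k IH A; rewrite ltnS => Ak.
have [->|[x0 x0A]] := set_0Vmem A.
  by exists Leaf; split=> // x; rewrite !inE.
case: (@arg_maxP _ _ _ x0 (fun x => x \in A) pri x0A) => z zA zmax.
have small (B : {set 'I_n}) : B \subset A :\ z -> (#|B| < k)%N.
  move=> /subset_leq_card BA; apply: leq_trans Ak.
  by rewrite (cardsD1 z A) zA.
have [|l [lo lk lh]] := IH [set y in A | (y < z)%N]%SET.
  apply: small; apply/fintype.subsetP=> y; rewrite !inE => /andP[-> yz].
  by rewrite andbT; apply: contraTneq yz => ->; rewrite ltnn.
have [|r [ro rk rh]] := IH [set y in A | (z < y)%N]%SET.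
  apply: small; apply/fintype.subsetP=> y; rewrite !inE => /andP[-> yz].
  by rewrite andbT; apply: contraTneq yz => ->; rewrite ltnn.
have kE : keys (Node l z r) =i A.
  move=> x; rewrite /= mem_cat inE lk rk !inE.
  by have [xz|xz|/val_inj ->] := ltngtP (x : nat) z;
     rewrite ?eqxx ?zA ?andbT ?andbF -?val_eqE ?(ltn_eqF xz) ?(gtn_eqF xz) ?orbF.
exists (Node l z r); split=> //.
- rewrite /= lo ro !andbT; apply/andP; split; apply/allP=> y.
    by rewrite lk inE => /andP[].
  by rewrite rk inE => /andP[].
- move=> x y /= /or3P[/andP[/eqP -> xA]|/lh //|/rh //].
  by apply: zmax; rewrite -kE.
Qed.

Lemma treap_is_treap (R : realType) n (pri : 'I_n -> R) :
  is_treap pri (treap pri).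
Proof.
have [t [so tk th]] := treap_on pri [set: 'I_n]%SET.
rewrite /treap; case: xgetP => [_ _ //|/(_ t)[]].
by split=> //; split=> // x; rewrite tk inE.
Qed.

Lemma keys_left n (l r : tree n) z x : search_ordered (Node l z r) ->
  (x \in keys l) = (x \in keys (Node l z r)) && (x < z)%N.
Proof.
move=> /= /and4P[/allP al /allP ar _ _]; rewrite mem_cat !inE.
have [xl|_] /= := boolP (x \in keys l); first by rewrite (al _ xl).
have [xr|_] := boolP (x \in keys r); last first.
  by rewrite orbF; case: (x =P z) => // ->; rewrite ltnn.
by rewrite ltnNge (ltnW (ar _ xr)) andbF.
Qed.

Lemma keys_right n (l r : tree n) z x : search_ordered (Node l z r) ->
  (x \in keys r) = (x \in keys (Node l z r)) && (z < x)%N.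
Proof.
move=> /= /and4P[/allP al /allP ar _ _]; rewrite mem_cat !inE.
have [xr|_] /= := boolP (x \in keys r); first by rewrite (ar _ xr) !orbT.
have [xl|_] := boolP (x \in keys l).
  by rewrite ltnNge (ltnW (al _ xl)) andbF.
by rewrite orbF /=; case: (x =P z) => // ->; rewrite ltnn.
Qed.

Lemma treap_unique_on (R : realType) n (pri : 'I_n -> R) (t t' : tree n) :
  injective pri -> search_ordered t -> search_ordered t' ->
  keys t =i keys t' ->
  (forall x y, ancestor t y x -> pri x <= pri y) ->
  (forall x y, ancestor t' y x -> pri x <= pri y) -> t = t'.
Proof.
move=> ip; elim: t t' => [|l IHl z r IHr] [|l' z' r'] //.
- by move=> _ _ /(_ z'); rewrite /= mem_cat !inE eqxx orbT.
- by move=> _ _ /(_ z); rewrite /= mem_cat !inE eqxx orbT.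
move=> so so' kE h h'.
have zz : z = z'.
  apply: ip; apply/eqP; rewrite eq_le; apply/andP; split.
    by apply: h'; have := kE z; rewrite /= !mem_cat !inE !eqxx orbT => <-.
  by apply: h; have := kE z'; rewrite /= !mem_cat !inE !eqxx orbT => ->.
subst z'.
have lE : keys l =i keys l' by move=> x; rewrite (keys_left _ so) (keys_left _ so') kE.
have rE : keys r =i keys r' by move=> x; rewrite (keys_right _ so) (keys_right _ so') kE.
move: so so' => /= /and4P[_ _ sl sr] /and4P[_ _ sl' sr'].
rewrite (IHl l') //; first rewrite (IHr r') //.
- by move=> x y a; apply: h; rewrite /= a !orbT.
- by move=> x y a; apply: h'; rewrite /= a !orbT.
- by move=> x y a; apply: h; rewrite /= a !orbT.
- by move=> x y a; apply: h'; rewrite /= a !orbT.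
Qed.

Lemma treap_unique (R : realType) n (pri : 'I_n -> R) (t : tree n) :
  injective pri -> is_treap pri t -> t = treap pri.
Proof.
move=> ip [[so tk] th]; have [[so' tk'] th'] := treap_is_treap pri.
by apply: (treap_unique_on ip) => // x; rewrite tk tk'.
Qed.

Lemma bst_exists n : exists t : tree n, is_bst t.
Proof.
suff aux k : (k <= n)%N -> exists t : tree n,
    search_ordered t /\ forall x : 'I_n, (x \in keys t) = (x < k)%N.
  have [t [so tk]] := aux n (leqnn n).
  by exists t; split=> // x; rewrite tk ltn_ord.
elim: k => [|k IH] kn; first by exists Leaf; split=> // x; rewrite ltn0.
have [t [so tk]] := IH (ltnW kn).
exists (Node t (Ordinal kn) Leaf); split=> [|x].
  by rewrite /= so !andbT; apply/allP=> y; rewrite tk.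
by rewrite /= mem_cat tk !inE -val_eqE /= ltnS (leq_eqVlt x) orbC.
Qed.

Lemma optimal_bst_exists n m (X : m.-tuple 'I_n) :
  exists t : tree n, is_optimal_bst X t.
Proof.
pose p k := `[< exists t : tree n, is_bst t /\ access_cost t X = k >].
have ex_p : exists k, p k.
  by have [t bt] := bst_exists n; exists (access_cost t X); apply/asboolP; exists t.
have [k /asboolP[t [bt <-]] kmin] := ex_minnP ex_p.
exists t; split=> // t' bt'.
by apply: kmin; apply/asboolP; exists t'.
Qed.

(* Main.v *)
(* An ancestor y of x dominates all priorities between x and y. Since the offsets
   lie in (0, 1), an ancestor of x has tier floor (log2 log2 (m / f)) at most that
   of x, and inside its own tier it carries the largest offset of the interval.
   Tier k has fewer than 2 ^ 2 ^ (k + 1) items, because their frequencies exceed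
   m / 2 ^ 2 ^ (k + 1). If the probability that one offset exceeds s others is
   O(1 / s), a harmonic sum bounds the expected number of ancestors of tier k by
   O(2 ^ k), and these geometric terms add up to O(log2 (m / f_x)).

   Five-wise independence gives the O(1 / s) bound: for an offset in a dyadic
   window at distance about t below 1, the s competitors are split in two halves,
   and the product of the squared centred counts of competitors above 1 - t has
   expectation O((s t) ^ 2), so the chance that there is none is O(1 / (s t) ^ 2);
   this is summed over t = 2 ^ - q.

   The depths of any search tree satisfy Kraft's inequality in base 4, so by Gibbs'
   inequality the entropy is at most twice the cost of the optimal tree. *)
Require Import Defs.
From mathcomp Require Import all_boot all_order all_algebra.
From mathcomp Require Import all_classical all_reals all_analysis.
From mathcomp Require Import measurable_realfun.
From mathcomp Require Import ring lra zify.

Set Implicit Arguments.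
Unset Strict Implicit.
Unset Printing Implicit Defensive.

Import Order.TTheory GRing.Theory Num.Theory.

Local Open Scope ring_scope.

(** * Search trees and entropy *)

(** The keys of a subtree form an interval of the key set, so a key between [x] and [y] follows both
    of them into the same subtree at every step of the descent. *)
Lemma ancestor_between n (t : tree n) (y x z : 'I_n) :
  search_ordered t -> z \in keys t -> ancestor t y x ->
  (y <= z <= x)%N || (x <= z <= y)%N -> ancestor t y z.
Proof.
elim: t => [//|l IHl k r IHr] so zt /= /or3P[/andP[/eqP -> _]|a|a] h.
- by rewrite eqxx zt.
- have /andP[yl xl] := ancestor_key a.
  move: (yl) (xl); rewrite !(keys_left _ so) => /andP[_ yk] /andP[_ xk].
  have zl : z \in keys l.
    rewrite (keys_left _ so) zt /=.
    by case/orP: h => /andP[_ zy]; apply: leq_ltn_trans zy _.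
  move: so => /= /and4P[_ _ sl _].
  by rewrite (IHl sl zl a h) orbT.
- have /andP[yr xr] := ancestor_key a.
  move: (yr) (xr); rewrite !(keys_right _ so) => /andP[_ yk] /andP[_ xk].
  have zr : z \in keys r.
    rewrite (keys_right _ so) zt /=.
    by case/orP: h => /andP[zy _]; apply: leq_trans zy.
  move: so => /= /and4P[_ _ _ sr].
  by rewrite (IHr sr zr a h) !orbT.
Qed.

Lemma ancestor_refl n (t : tree n) x : x \in keys t -> ancestor t x x.
Proof.
elim: t => [//|l IHl k r IHr] /=; rewrite mem_cat inE.
case/or3P => [/IHl ->|/eqP ->|/IHr ->]; rewrite /= ?orbT //.
by rewrite !eqxx orbT.
Qed.

Lemma depth_gt0 n (t : tree n) x : x \in keys t -> (0 < depth t x)%N.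
Proof.
by move=> xt; apply/card_gt0P; exists x; rewrite inE ancestor_refl.
Qed.

Lemma depth_left n (l r : tree n) k x : search_ordered (Node l k r) ->
  x \in keys l -> (depth l x < depth (Node l k r) x)%N.
Proof.
move=> so xl; apply: proper_card; apply/properP; split.
  by apply/fintype.subsetP => y; rewrite !inE /= => ->; rewrite orbT.
exists k; rewrite !inE /=; first by rewrite eqxx mem_cat xl.
apply/negP => /ancestor_key/andP[kl _].
by move: kl; rewrite (keys_left _ so) ltnn andbF.
Qed.

Lemma depth_right n (l r : tree n) k x : search_ordered (Node l k r) ->
  x \in keys r -> (depth r x < depth (Node l k r) x)%N.
Proof.
move=> so xr; apply: proper_card; apply/properP; split.
  by apply/fintype.subsetP => y; rewrite !inE /= => ->; rewrite !orbT.
exists k; rewrite !inE /=; first by rewrite eqxx mem_cat inE xr !orbT.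
apply/negP => /ancestor_key/andP[kr _].
by move: kr; rewrite (keys_right _ so) ltnn andbF.
Qed.

(* Base 4 leaves room for the root: 1/4 (1 + 1 + 1) < 1 drives the induction. *)
Lemma kraft_bst (R : realType) n (t : tree n) : search_ordered t ->
  \sum_(x | x \in keys t) (4%:R^-1 : R) ^+ depth t x <= 1.
Proof.
elim: t => [|l IHl k r IHr] so; first by rewrite big_pred0.
have q0 : 0 <= (4%:R^-1 : R) by rewrite invr_ge0.
have q1 : (4%:R^-1 : R) <= 1 by rewrite invf_le1 ?ler1n ?ltr0n.
have kt : k \in keys (Node l k r) by rewrite /= mem_cat inE eqxx orbT.
rewrite (bigD1 k) //= (bigID (fun x : 'I_n => (x < k)%N)) /=.
have [/= _ _ sl sr] := and4P so.
have sub (u : tree n) (p : pred 'I_n) : p =1 [in keys u] ->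
    (forall x, x \in keys u -> (depth u x < depth (Node l k r) x)%N) ->
    \sum_(x | x \in keys u) (4%:R^-1 : R) ^+ depth u x <= 1 ->
    \sum_(x | p x) (4%:R^-1 : R) ^+ depth (Node l k r) x <= 4%:R^-1.
  move=> pE dlt h; rewrite (eq_bigl _ _ pE).
  rewrite -[leRHS]mulr1; apply: le_trans (ler_wpM2l q0 h).
  rewrite mulr_sumr; apply: ler_sum => x xu; rewrite -exprS.
  by apply: ler_wiXn2l => //; exact: dlt.
apply: (@le_trans _ _ (4%:R^-1 + (4%:R^-1 + 4%:R^-1))); last by lra.
apply: lerD; last apply: lerD.
- by rewrite -[leRHS]expr1 ler_wiXn2l // depth_gt0.
- apply: (sub l) => [x|x|]; [|exact: depth_left|exact: IHl].
  rewrite (keys_left _ so) -andbA; congr (_ && _).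
  by rewrite -val_eqE /=; case: ltngtP.
- apply: (sub r) => [x|x|]; [|exact: depth_right|exact: IHr].
  rewrite (keys_right _ so) -andbA; congr (_ && _).
  by rewrite -val_eqE /=; case: ltngtP.
Qed.

Lemma sum_accesses (V : nmodType) n m (X : m.-tuple 'I_n) (F : 'I_n -> V) :
  \sum_(i < m) F (tnth X i) = \sum_x F x *+ freq X x.
Proof.
rewrite (partition_big (tnth X) xpredT) //=; apply: eq_bigr => x _.
rewrite (eq_bigr (fun=> F x)) => [|i /eqP -> //].
by rewrite sumr_const /freq cardsE.
Qed.

Lemma sum_freq n m (X : m.-tuple 'I_n) : (\sum_x freq X x = m)%N.
Proof.
have := sum_accesses X (fun=> 1%N); rewrite sumr_const card_ord => /esym.
rewrite natn => {2}<-; apply: eq_bigr => x _; exact/esym/natn.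
Qed.

Lemma access_costE (R : realType) n m (X : m.-tuple 'I_n) (t : tree n) :
  (access_cost t X)%:R = \sum_x (freq X x)%:R * (depth t x)%:R :> R.
Proof.
rewrite /access_cost natr_sum (sum_accesses X (fun x => (depth t x)%:R)).
by apply: eq_bigr => x _; rewrite mulr_natl.
Qed.

Lemma ln2_gt0 (R : realType) : 0 < ln 2 :> R.
Proof. by rewrite ln_gt0 // ltr1n. Qed.

(* Gibbs' inequality, from ln a <= a - 1 at a = 4 ^- depth * m / f. *)
Lemma entropy_le_cost (R : realType) n m (X : m.-tuple 'I_n) (t : tree n) :
  (forall x, (1 <= freq X x)%N) -> is_bst t ->
  \sum_(x < n) (freq X x)%:R * log2 (m%:R / (freq X x)%:R) <=
    2 * (access_cost t X)%:R :> R.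
Proof.
move=> f1 [so tk]; rewrite access_costE.
have l2 := ln2_gt0 R.
pose q : R := 4%:R^-1.
have q0 : 0 < q by rewrite invr_gt0.
(* The part in [2 * ln 2 = ln 4] sums to the cost; the remainder [m * q ^+ depth - freq] sums to at
   most 0, by Kraft's inequality and [sum_freq]. *)
have pt x : (freq X x)%:R * ln (m%:R / (freq X x)%:R) <=
    (freq X x)%:R * (depth t x)%:R * (2 * ln 2) +
    (m%:R * q ^+ depth t x - (freq X x)%:R) :> R.
  have f0 : 0 < (freq X x)%:R :> R by rewrite ltr0n f1.
  have m0 : 0 < m%:R :> R.
    rewrite ltr0n -(sum_freq X) (bigD1 x) //=.
    by rewrite addn_gt0 f1.
  have qd : 0 < q ^+ depth t x by rewrite exprn_gt0.
  have a0 : 0 < q ^+ depth t x * (m%:R / (freq X x)%:R) by rewrite mulr_gt0 ?divr_gt0.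
  have := @le_ln1Dx R (q ^+ depth t x * (m%:R / (freq X x)%:R) - 1).
  rewrite [1 + _]addrC subrK ltrBrDl addrN => /(_ a0).
  have lq : ln q = - (2 * ln 2).
    rewrite /q lnV ?posrE // (_ : 4%:R = 2 ^+ 2); last by rewrite expr2 -natrM.
    by rewrite lnXn // mulr_natl.
  rewrite lnM ?posrE ?divr_gt0 // lnXn // lq => /(ler_wpM2l (ltW f0)).
  have e : (freq X x)%:R * (q ^+ depth t x * (m%:R / (freq X x)%:R)) =
      m%:R * q ^+ depth t x.
    by rewrite mulrCA [(freq X x)%:R * _]mulrC divfK ?gt_eqF // mulrC.
  rewrite mulrBr e mulr1 mulrDr -[_ *+ depth _ _]mulr_natr.
  by lra.
rewrite -(ler_pM2r l2) [leRHS]mulrC mulrA mulr_suml.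
rewrite (eq_bigr (fun x => (freq X x)%:R * ln (m%:R / (freq X x)%:R))) => [|x _].
  2: by rewrite /log2 -mulrA divfK ?gt_eqF.
apply: (le_trans (ler_sum _ (fun x _ => pt x))).
rewrite big_split /= -mulr_suml sumrB -mulr_sumr -natr_sum sum_freq.
have K : \sum_x q ^+ depth t x <= 1 by rewrite -(eq_bigl _ _ tk); exact: kraft_bst.
have : m%:R * (\sum_i q ^+ depth t i) <= m%:R * 1 := ler_wpM2l (ler0n _ _) K.
by lra.
Qed.

(** * Harmonic sums over ranks *)

(** The element with the largest [f] has rank [#|U| - 1] and is counted in no other rank, so
    removing it strips the last harmonic term only. *)
Lemma rank_sum (R : realType) (I : finType) (f : I -> nat) (U : {set I}) :
  {in U &, injective f} ->
  \sum_(y in U) (#|[set z in U | (f z < f y)%N]|.+1%:R^-1 : R) =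
  \sum_(j < #|U|) j.+1%:R^-1.
Proof.
have [k] := ubnP #|U|; elim: k U => // k IH U; rewrite ltnS => Uk fi.
have [->|[x0 x0U]] := set_0Vmem U; first by rewrite cards0 big_set0 big_ord0.
case: (@arg_maxnP _ x0 (mem U) f x0U) => y /= yU ymax.
have cU : #|U| = #|U :\ y|.+1 by rewrite (cardsD1 y) yU.
rewrite (big_setD1 y) //= cU big_ord_recr /= addrC; congr (_ + _); last first.
  congr (_.+1%:R^-1); apply: eq_card => z; rewrite !inE.
  have [->|zy] := eqVneq z y; first by rewrite ltnn andbF.
  have [zU|//] := boolP (z \in U); rewrite /= ltn_neqAle ymax // andbT.
  by apply: contra_neq zy; exact: fi.
rewrite -IH; first last.
- by move=> a b /setD1P[_ aU] /setD1P[_ bU]; exact: fi.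
- by rewrite cU in Uk.
apply: eq_bigr => x /setD1P[xy xU]; congr (_.+1%:R^-1).
apply: eq_card => z; rewrite !inE.
have [->|//] := eqVneq z y.
by rewrite yU /= ltnNge ymax.
Qed.

(** The [2 ^ k] terms with [2 ^ k <= j < 2 ^ k.+1] are each at most [2 ^- k], so a dyadic block adds
    at most 1. *)
Lemma harmonic_pow2 (R : realType) N k : (N <= 2 ^ k)%N ->
  \sum_(j < N) (j.+1%:R^-1 : R) <= k.+1%:R.
Proof.
move=> Nk; apply: (@le_trans _ _ (\sum_(0 <= j < 2 ^ k) j.+1%:R^-1)).
  rewrite -(big_mkord xpredT (fun j => j.+1%:R^-1)) (@big_cat_nat _ _ _ N 0 (2 ^ k)%N) //=.
  by rewrite lerDl sumr_ge0.
elim: k {N Nk} => [|k IH]; first by rewrite big_nat1 invr1.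
rewrite (@big_cat_nat _ _ _ (2 ^ k)%N) ?leq_exp2l //= -[k.+2%:R]natr1; apply: lerD => //.
rewrite [leRHS](_ : 1 = \sum_(2 ^ k <= j < 2 ^ k.+1) ((2 ^ k)%:R^-1 : R)); last first.
  by rewrite sumr_const_nat expnS mul2n -addnn addnK -[RHS]mulr_natl mulfV.
rewrite !big_nat; apply: ler_sum => j /andP[kj _].
by rewrite lef_pV2 ?posrE ?ltr0n ?expn_gt0 // ler_nat ltnW.
Qed.

(** * Tiers *)

Lemma log2_ltX (R : realType) (a : R) k :
  0 < a -> (log2 a < k%:R) = (a < 2 ^+ k).
Proof.
move=> a0; rewrite /log2 ltr_pdivrMr ?ln2_gt0 // mulr_natl -lnXn //.
by rewrite ltr_ln ?posrE ?exprn_gt0.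
Qed.

Lemma log2_geX (R : realType) (a : R) k :
  0 < a -> (k%:R <= log2 a) = (2 ^+ k <= a).
Proof. by move=> a0; rewrite !leNgt log2_ltX. Qed.

(** By geometric growth the last term dominates. The summand is the bound of [tier_sum] for tier
    [k]. *)
Lemma harmonic_tiers (R : realType) (K : nat) :
  \sum_(k < K.+1) (24 * (2 ^ k.+1).+1%:R : R) <= 144 * 2 ^+ K.
Proof.
have -> : 144 = 24 * 6 :> R by rewrite -natrM.
rewrite -mulr_sumr -mulrA ler_pM2l ?ltr0n //.
rewrite -natr_sum -natrX -natrM ler_nat.
suff : (\sum_(k < K.+1) (2 ^ k.+1).+1 <= 6 * 2 ^ K - 3)%N.
  by move/leq_trans; apply; rewrite leq_subr.
elim: K => [|K IH]; first by rewrite big_ord_recl big_ord0.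
rewrite big_ord_recr /=; apply: leq_trans (leq_add IH (leqnn _)) _.
have : (0 < 2 ^ K)%N by rewrite expn_gt0.
by rewrite !expnS; lia.
Qed.

Section tiers.
Variables (R : realType) (n m : nat) (X : m.-tuple 'I_n).
Hypothesis f1 : forall x : 'I_n, (1 <= freq X x)%N.

Definition info (x : 'I_n) : R := log2 (m%:R / (freq X x)%:R).

(** [priority] is [- tier x + delta x], so smaller tiers carry larger priorities when offsets lie in
    (0, 1). If [info x = 0], the default [ln 0 = 0] puts [x] in tier 0. *)
Definition tier (x : 'I_n) : int := Num.floor (log2 (info x)).

Lemma sum_freq_le (U : {set 'I_n}) : (\sum_(x in U) freq X x <= m)%N.
Proof. by rewrite -{2}(sum_freq X) [leqRHS](bigID (mem U)) /= leq_addr. Qed.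

Lemma freq2_le x y : x != y -> (freq X x + freq X y <= m)%N.
Proof.
move=> xy; have := sum_freq_le [set x; y]%SET.
by rewrite big_setU1 ?big_set1 // inE.
Qed.

Lemma freq_le x : (freq X x <= m)%N.
Proof. by have := sum_freq_le [set x]%SET; rewrite big_set1. Qed.

Let fgt0 x : 0 < (freq X x)%:R :> R.
Proof. by rewrite ltr0n. Qed.

Let ratio_gt0 x : 0 < m%:R / (freq X x)%:R :> R.
Proof. by rewrite divr_gt0 // ltr0n (leq_trans (f1 x)) ?freq_le. Qed.

Lemma info_ltX x k : (info x < k%:R) = (m < 2 ^ k * freq X x)%N.
Proof. by rewrite log2_ltX // ltr_pdivrMr // -natrX -natrM ltr_nat. Qed.

Lemma info_ge0 x : 0 <= info x.
Proof. by rewrite (_ : 0 = 0%:R) // leNgt info_ltX mul1n -leqNgt freq_le. Qed.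

Lemma tier_lt0 x : tier x < 0 -> (m < 2 * freq X x)%N.
Proof.
rewrite /tier floor_lt0 => h; rewrite -(info_ltX x 1).
have [->|L0] := eqVneq (info x) 0; first exact: ltr01.
have {}L0 : 0 < info x by rewrite lt0r L0 info_ge0.
by move: h; rewrite (_ : 0 = 0%:R) // log2_ltX.
Qed.

Lemma tier_small x (k : nat) : tier x = k%:Z -> (m < 2 ^ (2 ^ k.+1) * freq X x)%N.
Proof.
move=> kE; rewrite -info_ltX natrX.
have [->|L0] := eqVneq (info x) 0; first by rewrite exprn_gt0.
rewrite -log2_ltX; last by rewrite lt0r L0 info_ge0.
by have := floorD1_gt (log2 (info x)); rewrite -/(tier x) kE -natr1 intrD.
Qed.

(** Two items that each receive more than half of the accesses cannot coexist. *)
Lemma card_neg_tier : (#|[set x | (tier x < 0)%R]%SET| <= 1)%N.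
Proof.
apply/card_le1P => x; rewrite inE => tx y; rewrite !inE.
apply/idP/eqP => [/tier_lt0 hy|-> //]; have hx := tier_lt0 tx.
apply/eqP; apply: contraT => yx; have := freq2_le yx; lia.
Qed.

Lemma card_tier (k : nat) (U : {set 'I_n}) :
  (forall x, x \in U -> tier x = k%:Z) -> (#|U| <= 2 ^ (2 ^ k.+1))%N.
Proof.
move=> Uk; have [->|[x0 x0U]] := set_0Vmem U; first by rewrite cards0.
have m0 : (0 < m)%N by rewrite (leq_trans (f1 x0)) ?freq_le.
rewrite -(leq_pmul2r m0) -sum_nat_const.
apply: (@leq_trans (\sum_(x in U) 2 ^ (2 ^ k.+1) * freq X x)).
  by apply: leq_sum => x xU; exact/ltnW/tier_small/Uk.
by rewrite -big_distrr leq_mul2l sum_freq_le orbT.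
Qed.

(* An item accessed more than half of the time sits alone in the negative
   tiers: all others have information content larger than 1. *)
Lemma dominant_tier x y : info x < 1 -> y != x -> tier x < tier y.
Proof.
rewrite (_ : 1 = 1%:R) // info_ltX => fx yx.
have fxy := freq2_le yx.
have L1 : 1 <= info y by rewrite (_ : 1 = 1%:R) // leNgt info_ltX -leqNgt; lia.
(* [y] takes at least one access, so [freq X x < m] and [info x] is positive; this keeps
   [log2 (info x)] away from the default value at 0. *)
have L0 : 0 < info x.
  rewrite divr_gt0 ?ln2_gt0 // ln_gt0 // ltr_pdivlMr // mul1r ltr_nat.
  by have := f1 y; lia.
apply: (@lt_le_trans _ _ 0).
  by rewrite /tier floor_lt0 (_ : 0 = 0%:R) // log2_ltX // (_ : 2 ^+ 0 = 1%:R) // info_ltX.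
by rewrite /tier floor_ge0 (_ : 0 = 0%:R) // log2_geX ?(lt_le_trans _ L1).
Qed.

Lemma info_tier x (K : nat) : 1 <= info x -> tier x = K%:Z -> 2 ^+ K <= info x.
Proof.
move=> L1 KE; rewrite -log2_geX ?(lt_le_trans _ L1) //.
by have := floor_le (log2 (info x)); rewrite -/(tier x) KE.
Qed.

Lemma tier_nat x : 1 <= info x -> exists K : nat, tier x = K%:Z.
Proof.
move=> L1; have : 0 <= tier x.
  by rewrite /tier floor_ge0 (_ : 0 = 0%:R) // log2_geX ?(lt_le_trans _ L1).
by case: (tier x) => // K _; exists K.
Qed.

End tiers.

Local Open Scope classical_set_scope.
Local Open Scope ring_scope.

(** * Limited independence *)

Lemma Lfun1_indic d (T : measurableType d) (R : realType)
    (P : probability T R) (A : set T) :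
  measurable A -> (\1_A : T -> R) \in Lfun P 1.
Proof. by move=> mA; apply/Lfun1_integrable; exact: integrable_indic. Qed.

Lemma Lfun1_bigsum d (T : measurableType d) (R : realType)
    (P : probability T R) (J : finType) (Q : pred J) (F : J -> T -> R) :
  (forall j, Q j -> F j \in Lfun P 1) ->
  (fun w => \sum_(j | Q j) F j w) \in Lfun P 1.
Proof.
move=> F1; rewrite (_ : (fun _ => _) = \sum_(j | Q j) F j); last first.
  by apply/funext => w; rewrite fct_sumE.
exact: rpred_sum.
Qed.

Lemma expectation_bigsum d (T : measurableType d) (R : realType)
    (P : probability T R) (J : finType) (Q : pred J) (F : J -> T -> R) :
  (forall j, Q j -> F j \in Lfun P 1) ->
  ('E_P[fun w => (\sum_(j | Q j) F j w)%R] = \sum_(j | Q j) 'E_P[F j])%E.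
Proof.
move=> F1; rewrite (_ : (fun _ => _) = \sum_(f <- [seq F j | j <- enum Q]) f).
  rewrite expectation_sum ?big_map ?big_enum // => f /mapP[j].
  by rewrite mem_enum => Qj ->; exact: F1.
by apply/funext => w; rewrite big_map big_enum fct_sumE.
Qed.

Lemma prod_indic (T : Type) (R : realType) (I : finType) (A : I -> set T)
    (J : {set I}) (w : T) :
  \prod_(i in J) (\1_(A i) w : R) = \1_(\bigcap_(i in [set` J]) A i) w.
Proof.
have [wJ|wJ] := pselect ((\bigcap_(i in [set` J]) A i) w).
  rewrite indicE mem_set // big1 // => i iJ.
  by rewrite indicE mem_set //; exact: wJ.
rewrite indicE memNset //.
have [i iJ Ai] : exists2 i, i \in J & ~ A i w.
  by apply/not_exists2P => h; apply: wJ => i iJ; have := h i; case=> // /contrapT.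
by rewrite (bigD1 i) //= indicE memNset // mul0r.
Qed.

Section affine_products.
Context d (T : measurableType d) (R : realType) (P : probability T R).
Variables (I : finType) (A : I -> set T) (c e : I -> R).
Hypothesis mA : forall i, measurable (A i).

Let term (J : {set I}) (w : T) : R :=
  \prod_i (if i \in J then e i else c i) * \1_(\bigcap_(i in [set` J]) A i) w.

Let mcap (J : {set I}) : measurable (\bigcap_(i in [set` J]) A i).
Proof. by apply: fin_bigcap_measurable. Qed.

Let termL J : term J \in Lfun P 1.
Proof.
rewrite (_ : term J = (\prod_i (if i \in J then e i else c i)) *:
  (\1_(\bigcap_(i in [set` J]) A i) : T -> R)); last by apply/funext.
by apply: rpredZ; exact: Lfun1_indic.
Qed.

Let prodE w : \prod_i (c i + e i * \1_(A i) w) = \sum_J term J w.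
Proof.
under eq_bigr do rewrite addrC.
rewrite bigA_distr; apply: eq_bigr => J _; rewrite /term -prod_indic.
rewrite (bigID (mem J)) [in RHS](bigID (mem J)) /= mulrAC -big_split /=; congr (_ * _).
  by apply: eq_bigr => i ->.
by apply: eq_bigr => i /negbTE ->.
Qed.

Lemma Lfun1_prod_affine :
  (fun w => \prod_i (c i + e i * \1_(A i) w)) \in Lfun P 1.
Proof. by under eq_fun do rewrite prodE; exact: Lfun1_bigsum. Qed.

(** Expand the product over the subsets [J] on which the slope is chosen. Those not inside the
    support of [e] vanish on both sides, so limited independence suffices although the product runs
    over all of [I]. *)
Lemma expectation_prod_affine :
  (forall J : {set I}, J \subset [set i | e i != 0]%SET ->
    P (\bigcap_(i in [set` J]) A i) = (\prod_(i in J) P (A i))%E) ->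
  ('E_P[fun w => (\prod_i (c i + e i * \1_(A i) w))%R] =
    (\prod_i (c i + e i * fine (P (A i))))%:E)%E.
Proof.
move=> ind; under eq_fun do rewrite prodE.
rewrite expectation_bigsum //.
rewrite [in RHS](eq_bigr (fun i => e i * fine (P (A i)) + c i)) => [|i _]; last first.
  by rewrite addrC.
rewrite bigA_distr -sumEFin; apply: eq_bigr => J _.
have -> : ('E_P[term J])%E = ((\prod_i (if i \in J then e i else c i))%:E *
    P (\bigcap_(i in [set` J]) A i))%E.
  rewrite -expectation_indic // -expectationZl; last exact: Lfun1_indic.
  by congr expectation; apply/funext => w; rewrite /term /= mulrC.
have [Je|/subsetPn[i iJ]] := boolP (J \subset [set i | e i != 0]%SET); last first.
  rewrite inE negbK => /eqP ei0.
  by rewrite (bigD1 i) //= iJ ei0 mul0r mul0e [in RHS](bigD1 i) //= iJ ei0 !mul0r.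
rewrite ind // (_ : (\prod_(i in J) P (A i))%E = (\prod_(i in J) fine (P (A i)))%:E).
  rewrite -EFinM; congr _%:E.
  rewrite (bigID (mem J)) [in RHS](bigID (mem J)) /= mulrAC -big_split /=; congr (_ * _).
    by apply: eq_bigr => i ->.
  by apply: eq_bigr => i /negbTE ->.
rewrite -prodEFin; apply: eq_bigr => i _; rewrite fineK // fin_num_measure //.
Qed.

End affine_products.

Lemma prob_le_bigsum d (T : measurableType d) (R : realType)
    (P : probability T R) (J : finType) (A : set T) (B : J -> set T) :
  measurable A -> (forall j, measurable (B j)) ->
  (forall w, A w -> exists j, B j w) ->
  fine (P A) <= \sum_j fine (P (B j)).
Proof.
move=> mA mB AB; rewrite -lee_fin -sumEFin fineK ?fin_num_measure //.
under eq_bigr do rewrite fineK ?fin_num_measure //.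
rewrite -expectation_indic //.
under eq_bigr do rewrite -expectation_indic //.
rewrite -expectation_bigsum => [|j _]; last exact: Lfun1_indic.
apply: expectation_le.
- exact: measurable_indic.
- by apply: measurable_sum => j; exact: measurable_indic.
- by move=> w; rewrite indicE.
- by move=> w; rewrite sumr_ge0.
- apply: aeW => w; have [Aw|Aw] := pselect (A w); last first.
    by rewrite indicE memNset // sumr_ge0.
  have [j Bj] := AB w Aw.
  by rewrite (bigD1 j) //= !indicE !mem_set // lerDl sumr_ge0.
Qed.

(** Spreads a single factor over all indices; when several such products are multiplied the
    exponents add up, which handles coinciding indices uniformly. *)
Lemma prod_expr_eq (R : comPzSemiRingType) (I : finType) (F : I -> R) (i : I) :
  \prod_k F k ^+ (k == i) = F i.
Proof.
by rewrite (bigD1 i) //= eqxx big1 ?mulr1 // => k /negbTE ->.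
Qed.

(** * Second moments over two disjoint sets *)

Section split_second_moment.
Context d (T : measurableType d) (R : realType) (P : probability T R).
Variables (I : finType) (A : I -> set T) (j : I) (U V : {set I}) (t : R).
Hypothesis mA : forall i, measurable (A i).
Hypothesis t01 : 0 < t <= 1.
Hypothesis UV : [disjoint U & V]%B.
Hypothesis jU : j \notin U.
Hypothesis jV : j \notin V.
Hypothesis PA : forall i, (i \in U) || (i \in V) -> P (A i) = t%:E.
Hypothesis ind : forall S : {set I}, (#|S| <= 5)%N ->
  P (\bigcap_(i in [set` S]) A i) = (\prod_(i in S) P (A i))%E.

(** When [P (A i) = t] this has mean 0 and variance [t^-1 - 1]; it equals 1 off [A i]. *)
Let g i w : R := 1 - t^-1 * \1_(A i) w.
Let term i i' l l' w : R := \1_(A j) w * (g i w * g i' w) * (g l w * g l' w).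
Let cnt (i i' l l' k : I) : nat := (k == i) + (k == i') + (k == l) + (k == l').
(** As an indicator is 0 or 1, [g k w ^+ n] is [1 + slope n k * \1_(A k) w] for [k != j]; the index
    [j] carries the bare indicator, with constant 0 and slope 1. *)
Let coef (k : I) : R := if k == j then 0 else 1.
Let slope n (k : I) : R := if k == j then 1 else (1 - t^-1) ^+ n - 1.

Let outside i : (i \in U) || (i \in V) -> (i == j) = false.
Proof. by case: eqP => // ->; rewrite (negbTE jU) (negbTE jV). Qed.

(* Grouped by index, each factor of the product is an affine function of one
   indicator, whatever coincidences there are among i, i', l and l'. *)
Let termE i i' l l' w : i \in U -> i' \in U -> l \in V -> l' \in V ->
  term i i' l l' w =
  \prod_k (coef k + slope (cnt i i' l l' k) k * \1_(A k) w).
Proof.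
move=> iU iU' lV lV'; pose h k : R := if k == j then \1_(A j) w else 1.
transitivity (\prod_k (h k * g k w ^+ (k == i) * g k w ^+ (k == i') *
    g k w ^+ (k == l) * g k w ^+ (k == l'))).
  rewrite !big_split /= !prod_expr_eq (bigD1 j) //= big1 /h ?eqxx; last first.
    by move=> k /negbTE ->.
  by rewrite /term mulr1 !mulrA.
apply: eq_bigr => k _; rewrite -!mulrA -!exprD !addnA -/(cnt i i' l l' k).
rewrite /h /coef /slope; have [->|_] := eqVneq k j.
  rewrite /cnt ![j == _]eq_sym !outside ?iU ?iU' ?lV ?lV' ?orbT //.
  by rewrite expr0 mulr1 mul1r add0r.
rewrite mul1r /g indicE; case: (w \in A k); rewrite ?mulr1 ?mulr0 ?subr0 ?expr1n ?addr0 //.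
by rewrite [RHS]addrC subrK.
Qed.

Let term_Lfun1 i i' l l' : i \in U -> i' \in U -> l \in V -> l' \in V ->
  term i i' l l' \in Lfun P 1.
Proof.
move=> iU iU' lV lV'; rewrite (_ : term _ _ _ _ =
  fun w => \prod_k (coef k + slope (cnt i i' l l' k) k * \1_(A k) w)).
  exact: Lfun1_prod_affine.
by apply/funext => w; rewrite termE.
Qed.

Let mean1 k : (k \in U) || (k \in V) -> coef k + slope 1 k * fine (P (A k)) = 0.
Proof.
move=> kUV; rewrite /coef /slope outside // PA //= expr1 addrAC subrr add0r mulNr.
by rewrite mulVf ?subrr // gt_eqF; case/andP: t01.
Qed.

(** An index that occurs only once gives a factor of mean 0. As [U] and [V] are disjoint, only
    [i = i'] with [l = l'] survives, and each pair contributes the variance [t^-1 - 1]. *)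
Let expectation_term i i' l l' : i \in U -> i' \in U -> l \in V -> l' \in V ->
  ('E_P[term i i' l l'])%E =
  (if (i == i') && (l == l') then fine (P (A j)) * (t^-1 - 1) ^+ 2 else 0)%:E.
Proof.
move=> iU iU' lV lV'; rewrite (_ : term _ _ _ _ =
  fun w => \prod_k (coef k + slope (cnt i i' l l' k) k * \1_(A k) w)); last first.
  by apply/funext => w; rewrite termE.
rewrite expectation_prod_affine //; last first.
  (* The slope vanishes off the five indices [j, i, i', l, l']: this is where five-wise independence
     enters. *)
  move=> J Je; apply: ind.
  apply: (@leq_trans #|[:: j; i; i'; l; l']|); last exact: card_size.
  apply: subset_leq_card; apply: (fintype.subset_trans Je).
  apply/fintype.subsetP => k; rewrite !inE; apply: contraR.
  rewrite !negb_or => /and5P[kj ki ki' kl kl'].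
  by rewrite /slope (negbTE kj) /cnt (negbTE ki) (negbTE ki') (negbTE kl)
    (negbTE kl') expr0 subrr.
have neq u v : u \in U -> v \in V -> (u == v) = false.
  by move=> uU vV; apply: contraTF uU => /eqP ->; rewrite (disjointFl UV).
have [<-|ii'] /= := eqVneq i i'; last first.
  congr _%:E; rewrite (bigD1 i) //= /cnt eqxx (negbTE ii') !neq //=.
  by rewrite mean1 ?iU ?mul0r.
have [<-|ll'] /= := eqVneq l l'; last first.
  congr _%:E; rewrite (bigD1 l) //= /cnt eqxx (negbTE ll') ![l == _]eq_sym !neq //=.
  by rewrite mean1 ?lV ?orbT ?mul0r.
congr _%:E; pose h k : R := if k == j then fine (P (A j)) else 1.
transitivity (\prod_k (h k * (t^-1 - 1) ^+ (k == i) * (t^-1 - 1) ^+ (k == l))).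
  apply: eq_bigr => k _; rewrite /h /coef /slope /cnt.
  have [->|kj] := eqVneq k j.
    rewrite ![j == _]eq_sym !outside ?iU ?lV ?orbT //.
    by rewrite !expr0 !mulr1 add0r mul1r.
  have tn0 : t != 0 by rewrite gt_eqF; case/andP: t01.
  have [->|ki] := eqVneq k i.
    rewrite neq // PA ?iU //= mul1r expr1 expr0 mulr1.
    by field.
  have [->|kl] := eqVneq k l; last by rewrite !expr0 subrr mul0r addr0 !mulr1.
  rewrite PA ?lV ?orbT //= !mul1r.
  by field.
rewrite !big_split /= (prod_expr_eq (fun=> t^-1 - 1)) (prod_expr_eq (fun=> t^-1 - 1)).
by rewrite (bigD1 j) //= big1 /h ?eqxx ?mulr1 ?mulrA // => k /negbTE ->.
Qed.

(** On the event each [g] equals 1, so [S] equals [(#|U| * #|V|) ^ 2]. Markov's inequality applies: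
    only the diagonal terms contribute to the mean of [S], and [t^-1 - 1 <= t^-1]. *)
Lemma split_second_moment : (0 < #|U|)%N -> (0 < #|V|)%N ->
  fine (P (A j `&` \bigcap_(i in [set` (U :|: V)%SET]) ~` A i)) <=
  fine (P (A j)) / (t ^+ 2 * #|U|%:R * #|V|%:R).
Proof.
move=> U0 V0; set E := A j `&` _.
have mE : measurable E.
  apply: measurableI => //; apply: fin_bigcap_measurable => // i _.
  exact: measurableC.
pose K : R := (#|U|%:R * #|V|%:R) ^- 2.
pose S w : R := \sum_(i in U) \sum_(i' in U) \sum_(l in V) \sum_(l' in V)
  term i i' l l' w.
have u0 : (#|U|%:R : R) != 0 by rewrite pnatr_eq0 -lt0n.
have v0 : (#|V|%:R : R) != 0 by rewrite pnatr_eq0 -lt0n.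
have SE w : S w = \1_(A j) w * ((\sum_(i in U) g i w) * (\sum_(l in V) g l w)) ^+ 2.
  rewrite exprMn !expr2 [X in _ = _ * (X * _)]big_distrlr /=.
  rewrite mulr_suml mulr_sumr; apply: eq_bigr => i _.
  rewrite mulr_suml mulr_sumr; apply: eq_bigr => i' _.
  rewrite mulrA big_distrlr mulr_sumr; apply: eq_bigr => l _.
  by rewrite mulr_sumr.
have S0 w : 0 <= S w by rewrite SE mulr_ge0 ?sqr_ge0 // indicE.
have SL : S \in Lfun P 1.
  by do 4 (apply: Lfun1_bigsum => ? ?); exact: term_Lfun1.
have ES : ('E_P[S])%E = (#|U|%:R * #|V|%:R * (fine (P (A j)) * (t^-1 - 1) ^+ 2))%:E.
  rewrite /S expectation_bigsum => [|i iU]; last first.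
    by do 3 (apply: Lfun1_bigsum => ? ?); exact: term_Lfun1.
  transitivity (\sum_(i in U) (#|V|%:R * (fine (P (A j)) * (t^-1 - 1) ^+ 2))%:E)%E; last first.
    by rewrite sumEFin sumr_const -[in RHS]mulrA [in RHS]mulr_natl.
  apply: eq_bigr => i iU; rewrite expectation_bigsum => [|i' iU']; last first.
    by do 2 (apply: Lfun1_bigsum => ? ?); exact: term_Lfun1.
  rewrite (bigD1 i) //= big1 ?adde0 => [|i' /andP[iU' ii']]; last first.
    rewrite expectation_bigsum => [|l lV]; last first.
      by apply: Lfun1_bigsum => ? ?; exact: term_Lfun1.
    rewrite big1 // => l lV; rewrite expectation_bigsum => [|l' lV']; last exact: term_Lfun1.
    by rewrite big1 // => l' lV'; rewrite expectation_term // eq_sym (negbTE ii').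
  rewrite expectation_bigsum => [|l lV]; last first.
    by apply: Lfun1_bigsum => ? ?; exact: term_Lfun1.
  rewrite mulr_natl -sumr_const -sumEFin; apply: eq_bigr => l lV.
  rewrite expectation_bigsum => [|l' lV']; last exact: term_Lfun1.
  rewrite (bigD1 l) //= big1 ?adde0 => [|l' /andP[lV' ll']].
    by rewrite expectation_term // !eqxx.
  by rewrite expectation_term // eqxx /= eq_sym (negbTE ll').
have K0 : 0 <= K by rewrite invr_ge0 sqr_ge0.
have le1 : ('E_P[\1_E] <= 'E_P[K \o* S])%E.
  apply: expectation_le.
  - exact: measurable_indic.
  - have := Lfun_scale K (lexx 1) SL.
    by rewrite inE => /andP[]; rewrite inE.
  - by move=> w; rewrite indicE.
  - by move=> w /=; exact: mulr_ge0.
  - apply: aeW => w /=; have [[Aj nA]|nE] := pselect (E w); last first.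
      by rewrite indicE memNset //; exact: mulr_ge0.
    have g1 i : (i \in U) || (i \in V) -> g i w = 1.
      move=> iUV; rewrite /g indicE memNset ?mulr0 ?subr0 //.
      by apply: nA; rewrite /= inE.
    rewrite SE !indicE !mem_set // mul1r (eq_bigr (fun=> 1)) => [|i iU]; last by rewrite g1 ?iU.
    rewrite sumr_const (eq_bigr (fun=> 1)) => [|i iV]; last by rewrite g1 ?iV ?orbT.
    by rewrite sumr_const /K mulfV // expf_neq0 // mulf_neq0.
move: le1; rewrite expectation_indic // expectationZl // ES -EFinM -lee_fin.
rewrite fineK ?fin_num_measure // => /le_trans; apply; rewrite lee_fin.
have [t0 t1] := andP t01.
have -> : K * (#|U|%:R * #|V|%:R * (fine (P (A j)) * (t^-1 - 1) ^+ 2)) =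
    fine (P (A j)) * ((t^-1 - 1) ^+ 2 / (#|U|%:R * #|V|%:R)).
  by rewrite /K; set c := (_ - 1) ^+ 2; field; rewrite u0 v0.
have -> : fine (P (A j)) / (t ^+ 2 * #|U|%:R * #|V|%:R) =
    fine (P (A j)) * (t^-1 ^+ 2 / (#|U|%:R * #|V|%:R)).
  by field; rewrite u0 v0 gt_eqF.
apply: ler_wpM2l; first by rewrite fine_ge0.
apply: ler_wpM2r; first by rewrite invr_ge0 mulr_ge0.
have : 1 <= t^-1 by rewrite invf_ge1.
by move=> ?; rewrite ler_pXn2r ?nnegrE ?subr_ge0 ?gerBl ?ler01 ?invr_ge0 // ltW.
Qed.

End split_second_moment.

(** * Uniform offsets and dyadic windows *)

Lemma uniform01_itv d (T : measurableType d) (R : realType)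
    (P : probability T R) (Y : {RV P >-> R}) (a b : R) (ba bb : bool) :
  uniform01 Y -> 0 <= a -> a <= b -> b <= 1 ->
  P (Y @^-1` [set` Interval (BSide ba a) (BSide bb b)]) = (b - a)%:E.
Proof.
move=> uY a0 ab b1.
have := uY [set` Interval (BSide ba a) (BSide bb b)] (measurable_itv _).
rewrite /distribution /pushforward => ->; rewrite /uniform_prob.
rewrite (eq_integral (cst 1%E)) => [|x]; last first.
  rewrite inE /= itv_boundlr => /andP[ax xb].
  rewrite /uniform_pdf subr0 invr1 ifT //; apply/andP; split.
    by apply: (le_trans a0); move: ax; case: (ba) => /=; rewrite bnd_simp // => /ltW.
  by apply: le_trans b1; move: xb; case: (bb) => /=; rewrite bnd_simp // => /ltW.
rewrite integral_cst // mul1e /= lebesgue_measure_itv /= lte_fin.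
by case: ltgtP ab => // -> _; rewrite subrr.
Qed.

Lemma measurable_rv_itv d (T : measurableType d) (R : realType)
    (P : probability T R) (Y : {RV P >-> R}) (i : interval R) :
  measurable (Y @^-1` [set` i]).
Proof. by apply: measurable_funPTI; exact: measurable_itv. Qed.

Lemma uniform01_outside d (T : measurableType d) (R : realType)
    (P : probability T R) (Y : {RV P >-> R}) :
  uniform01 Y -> P (Y @^-1` ~` `]0, 1[) = 0%E.
Proof.
move=> uY; rewrite preimage_setC probability_setC; last exact: measurable_rv_itv.
by rewrite uniform01_itv // subr0 subee.
Qed.

Lemma dyadic_scale (R : realType) (v : R) (s : nat) :
  0 <= v < 1 - 2 ^- s -> exists2 q, (q < s)%N &
    1 - 2 ^- q <= v < 1 - 2 ^- q.+1.
Proof.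
elim: s => [|s IH] /andP[v0 vs]; first by move: vs; rewrite expr0 invr1 subrr ltNge v0.
have [vlt|vge] := ltP v (1 - 2 ^- s); last by exists s; rewrite // vge vs.
have [|q qs h] := IH; first by rewrite v0.
by exists q => //; exact: ltnW.
Qed.

Lemma split_half (I : finType) (S : {set I}) (a : nat) : (a + a <= #|S|)%N ->
  exists U V : {set I}, [/\ U \subset S, V \subset S, [disjoint U & V]%B,
    #|U| = a & #|V| = a].
Proof.
move=> aS; pose U := [set x in take a (enum S)]%SET.
pose V := [set x in take a (drop a (enum S))]%SET.
have uS := enum_uniq S.
have sS : size (enum S) = #|S| by rewrite -cardE.
have sU : size (take a (enum S)) = a by rewrite size_takel // sS; lia.
have sV : size (take a (drop a (enum S))) = a.
  by rewrite size_takel // size_drop sS; lia.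
exists U, V; split.
- by apply/fintype.subsetP => x; rewrite inE => /mem_take; rewrite mem_enum.
- by apply/fintype.subsetP => x; rewrite inE => /mem_take /mem_drop; rewrite mem_enum.
- rewrite disjoint_subset; apply/fintype.subsetP => x; rewrite !inE => xU.
  apply/negP => /mem_take xV.
  move: uS; rewrite -(cat_take_drop a (enum S)) cat_uniq => /and3P[_ /hasPn /(_ _ xV)].
  by rewrite /= xU.
- rewrite cardsE (card_uniqP _) //; exact: take_uniq.
- rewrite cardsE (card_uniqP _) //; exact/take_uniq/drop_uniq.
Qed.

Lemma measurable_le_rv d (T : measurableType d) (R : realType) (f g : T -> R) :
  measurable_fun setT f -> measurable_fun setT g -> measurable [set w | f w <= g w].
Proof.
move=> mf mg; rewrite (_ : [set w | _] = setT `&` (fun w => f w <= g w) @^-1` [set true]).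
  exact: measurable_fun_ler.
by rewrite setTI.
Qed.

Section exceeds.
Context d (T : measurableType d) (R : realType) (P : probability T R).
Variables (I : finType) (Y : I -> {RV P >-> R}).
Hypothesis uY : forall i, uniform01 (Y i).
Hypothesis indY : kwise_independent 5 Y.

Definition exceeds (y : I) (S : {set I}) : set T :=
  \bigcap_(z in [set` S]) [set w | Y z w <= Y y w].

Lemma measurable_exceeds y S : measurable (exceeds y S).
Proof.
by apply: fin_bigcap_measurable => // z _; apply: measurable_le_rv.
Qed.

(** A competitor above [1 - t] would beat an offset of [y] below [1 - t]. The window of [y] and the
    range []1 - t, 1]] both have measure [t], so [split_second_moment] gives
    [t / (t ^ 2 * #|U| * #|V|)]. *)
Let exceeds_scale (y : I) (U V : {set I}) (t : R) : 0 < t -> t *+ 2 <= 1 ->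
  [disjoint U & V]%B -> y \notin U -> y \notin V ->
  (0 < #|U|)%N -> (0 < #|V|)%N ->
  fine (P (exceeds y (U :|: V)%SET `&` Y y @^-1` `[1 - t *+ 2, 1 - t[)) <=
  (t * #|U|%:R * #|V|%:R)^-1.
Proof.
move=> t0 t1 UV yU yV U0 V0.
pose B (i : I) : interval R := if i == y then `[1 - t *+ 2, 1 - t[ else `]1 - t, 1].
pose A i := Y i @^-1` [set` B i].
have mA i : measurable (A i) by exact: measurable_rv_itv.
have [a0 ab b1] : [/\ 0 <= 1 - t *+ 2, 1 - t *+ 2 <= 1 - t & 1 - t <= 1].
  by split; lra.
have PAy : P (A y) = t%:E.
  rewrite /A /B eqxx uniform01_itv //.
  by congr _%:E; lra.
have PA i : (i \in U) || (i \in V) -> P (A i) = t%:E.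
  move=> iUV; rewrite /A /B ifF; last first.
    by apply: contraTF iUV => /eqP ->; rewrite (negbTE yU) (negbTE yV).
  rewrite uniform01_itv //; last exact: le_trans ab.
  by congr _%:E; lra.
have t01 : 0 < t <= 1 by rewrite t0; lra.
have ind5 (S : {set I}) : (#|S| <= 5)%N ->
    P (\bigcap_(i in [set` S]) A i) = (\prod_(i in S) P (A i))%E.
  by move=> S5; apply: indY => // i; exact: measurable_itv.
have := split_second_moment mA t01 UV yU yV PA ind5 U0 V0.
rewrite PAy /= expr2 -!mulrA invfM mulVKf ?gt_eqF // => /(le_trans _); apply.
have mE : measurable (A y `&` \bigcap_(i in [set` (U :|: V)%SET]) ~` A i).
  apply: measurableI => //; apply: fin_bigcap_measurable => // i _.
  exact: measurableC.
apply: fine_le; rewrite ?fin_num_measure //.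
- by apply: measurableI; [exact: measurable_exceeds|exact: measurable_rv_itv].
- apply: le_measure; rewrite ?inE //.
    by apply: measurableI; [exact: measurable_exceeds|exact: measurable_rv_itv].
  move=> w [rec Yw]; split; first by rewrite /A /B eqxx.
  move=> i iUV; have := rec i iUV; rewrite /A /B /= ifF; last first.
    move: iUV => /=; rewrite inE; apply: contraTF => /eqP ->.
    by rewrite negb_or yU yV.
  move: Yw; rewrite /= !in_itv /= => /andP[_ yt] iy.
  by rewrite ltNge (le_trans iy (ltW yt)).
Qed.

(** With two subsets of size [2 ^ s], the top window costs [2 ^- s] and the others at most
    [2 * 2 ^- s] together. Since [#|S|.+1 <= 4 * 2 ^ s], the total [3 / 2 ^ s] is at most
    [12 / #|S|.+1]. *)
Lemma prob_exceeds y (S : {set I}) : y \notin S -> fine (P (exceeds y S)) <= 12 / #|S|.+1%:R.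
Proof.
move=> yS; have [S1|S2] := leqP #|S| 1.
  apply: (@le_trans _ _ 1).
    by rewrite -lee_fin fineK ?fin_num_measure ?probability_le1 //; exact: measurable_exceeds.
  by rewrite ler_pdivlMr ?mul1r ?ltr0n // ler_nat; lia.
(* The logarithm is positive and is renamed [s.+1], so that [2 ^ s.+1 <= #|S| < 2 ^ s.+2]. *)
have := trunc_log_bounds (isT : 1 < 2)%N (ltnW S2).
have : (0 < trunc_log 2 #|S|)%N by rewrite trunc_log_gt0.
case: (trunc_log 2 #|S|) => // s _ /andP[Sge Slt].
have [|U [V [US VS UV cU cV]]] := @split_half I S (2 ^ s).
  by rewrite addnn -mul2n -expnS.
have yU : y \notin U by apply: contraNN yS; exact/fintype.subsetP.
have yV : y \notin V by apply: contraNN yS; exact/fintype.subsetP.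
(* [None] is the null event of an offset outside (0, 1), [Some None] the top window, [Some (Some q)]
   the window at scale [t = 2 ^- q.+1]. *)
pose W (j : option (option 'I_s)) : set T := match j with
  | None => Y y @^-1` ~` `]0, 1[
  | Some None => Y y @^-1` `[1 - 2 ^- s, 1]
  | Some (Some q) => exceeds y (U :|: V)%SET `&`
      Y y @^-1` `[1 - 2 ^- q.+1 *+ 2, 1 - 2 ^- q.+1[
  end.
have p2 k : 0 < (2 ^- k : R) by rewrite invr_gt0 exprn_gt0.
have half k : 2 ^- k.+1 *+ 2 = 2 ^- k :> R.
  by rewrite exprS invfM -[LHS]mulr_natl mulVKf.
have le1 k : 2 ^- k <= 1 :> R.
  by rewrite invf_le1 ?exprn_gt0 // exprn_ege1 // ler1n.
have mW j : measurable (W j).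
  case: j => [[q|]|] /=; try exact: measurable_rv_itv.
    by apply: measurableI; [exact: measurable_exceeds|exact: measurable_rv_itv].
  by apply: measurable_funPTI; exact: measurableC.
apply: (@le_trans _ _ (\sum_j fine (P (W j)))).
  apply: prob_le_bigsum => //; first exact: measurable_exceeds.
  move=> w rec; have [Y01|nY] := pselect ((Y y @^-1` `]0, 1[) w); last by exists None.
  move: Y01; rewrite /= in_itv /= => /andP[Y0 Y1].
  have [Ylt|Yge] := ltP (Y y w) (1 - 2 ^- s); last first.
    by exists (Some None); rewrite /= in_itv /= Yge ltW.
  have [|q qs h] := @dyadic_scale R (Y y w) s; first by rewrite (ltW Y0).
  exists (Some (Some (Ordinal qs))); rewrite /= half; split.
    move=> z; rewrite /= inE => /orP zUV; apply: rec => /=.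
    by case: zUV; exact/fintype.subsetP.
  by rewrite in_itv.
have optE (J : finType) (f : option J -> R) : \sum_j f j = f None + \sum_j f (Some j).
  rewrite (bigD1 None) //=; congr (_ + _).
  rewrite (reindex_omap Some id) => [|[]//]; apply: eq_bigl => j.
  by rewrite /= eqxx.
rewrite !optE /= uniform01_outside // /= add0r.
rewrite uniform01_itv ?subr_ge0 ?gerBl ?le1 ?(ltW (p2 _)) //.
rewrite opprB addrCA subrr addr0 /=.
have scale q : fine (P (W (Some (Some q)))) <= (2 ^ q.+1)%:R / (4 ^ s)%:R.
  apply: le_trans (exceeds_scale _ _ UV yU yV _ _) _; rewrite ?half //.
  - by rewrite cU expn_gt0.
  - by rewrite cV expn_gt0.
  by rewrite cU cV -mulrA invfM invrK -natrM -expnMn [in X in _ <= X](natrX _ 2 q.+1).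
apply: (@le_trans _ _ (2 ^- s + \sum_(q < s) (2 ^ q.+1)%:R / (4 ^ s)%:R)).
  by rewrite lerD2l; apply: ler_sum => q _; exact: scale.
have geo : (\sum_(q < s) 2 ^ q.+1 <= 2 * 2 ^ s)%N.
  elim: (s) => [|k IH]; first by rewrite big_ord0.
  by rewrite big_ord_recr /= (leq_trans (leq_add IH (leqnn _))) // !expnS; lia.
rewrite -mulr_suml -natr_sum.
have s0 : (2 ^ s)%:R != 0 :> R by rewrite pnatr_eq0 expn_eq0.
have -> : 2 ^- s = (2 ^ s)%:R^-1 :> R by rewrite natrX.
have -> : (4 ^ s)%:R = (2 ^ s)%:R * (2 ^ s)%:R :> R by rewrite -natrM -expnMn.
apply: (@le_trans _ _ ((2 ^ s)%:R^-1 + 2 / (2 ^ s)%:R)).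
  rewrite lerD2l invfM mulrA ler_wpM2r ?invr_ge0 //.
  rewrite ler_pdivrMr ?ltr0n ?expn_gt0 // -natrM ler_nat.
  exact: geo.
rewrite (_ : _ + _ = 3 / (2 ^ s)%:R); last by field.
rewrite ler_pdivrMr ?ltr0n ?expn_gt0 // mulrAC ler_pdivlMr ?ltr0n //.
rewrite -!natrM ler_nat; move: Slt; rewrite !expnS; lia.
Qed.

End exceeds.

(** * Expected depth *)

(* The integral of a nonnegative function is a supremum over the simple
   functions below it, so that monotonicity needs no measurability. *)
Lemma le_expectation_ge0 d (T : measurableType d) (R : realType)
    (P : probability T R) (f g : T -> R) :
  (forall w, 0 <= f w) -> (forall w, f w <= g w) -> ('E_P[f] <= 'E_P[g])%E.
Proof.
move=> f0 fg; rewrite unlock !ge0_integralTE; first last.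
- by move=> w; rewrite lee_fin.
- by move=> w; rewrite lee_fin (le_trans _ (fg w)).
apply: ereal_sup_le => _ [h hf <-]; exists h => //= w.
by apply: le_trans (hf w) _; rewrite lee_fin.
Qed.

Lemma kwise_independentW d (T : measurableType d) (R : realType)
    (P : probability T R) (I : finType) (k l : nat) (Y : I -> {RV P >-> R}) :
  (k <= l)%N -> kwise_independent l Y -> kwise_independent k Y.
Proof. by move=> kl h S B Sk mB; apply: h => //; exact: leq_trans kl. Qed.

Section treap_depth.
Variables (R : realType) (n m : nat) (X : m.-tuple 'I_n).
Hypothesis f1 : forall x : 'I_n, (1 <= freq X x)%N.
Context d (Omega : measurableType d) (P : probability Omega R).
Variable delta : 'I_n -> {RV P >-> R}.
Hypothesis udelta : forall x, uniform01 (delta x).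
Hypothesis idelta : kwise_independent 5 delta.

Let pri w := priority X (fun x => delta x w).

Definition between (x y : 'I_n) : {set 'I_n} :=
  [set z : 'I_n | (y <= z <= x)%N || (x <= z <= y)%N]%SET.

(** Contains the event that [y] is an ancestor of [x], yet is stated on priorities alone and hence
    measurable, whereas the tree is chosen by [xget]. *)
Definition tops_interval (x y : 'I_n) : set Omega :=
  \bigcap_(z in [set` between x y]) [set w | pri w z <= pri w y].

Lemma measurable_tops_interval x y : measurable (tops_interval x y).
Proof.
apply: fin_bigcap_measurable => // z _; apply: measurable_le_rv.
  by apply: measurable_funD.
by apply: measurable_funD.
Qed.

(** [ancestor_between] and heap order give this for any tree satisfying [is_treap], so ties between
    priorities are harmless. *)
Lemma depth_treap_le (x : 'I_n) w :
  (depth (treap (pri w)) x)%:R <= \sum_y (\1_(tops_interval x y) w : R).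
Proof.
have [[so tk] tp] := treap_is_treap (pri w).
rewrite /depth -sum1_card natr_sum big_mkcond /=; apply: ler_sum => y _.
rewrite inE; case: ifP => // a; rewrite indicE mem_set // => z /=.
rewrite inE => zxy; apply: tp; apply: ancestor_between a _ => //.
Qed.

(** Tiers are integers, hence at least 1 apart, while offsets in (0, 1) differ by less than 1: [x]
    beats [y] unless an offset falls in the null set outside (0, 1). *)
Lemma prob_tops_interval_lower x y : tier R X x < tier R X y ->
  fine (P (tops_interval x y)) = 0.
Proof.
move=> xy; apply/eqP; rewrite eq_le fine_ge0 // andbT.
pose N (b : bool) : set Omega := delta (if b then x else y) @^-1` ~` `]0, 1[.
apply: le_trans (@prob_le_bigsum _ _ _ P _ _ N _ _ _) _.
- exact: measurable_tops_interval.
- by move=> b; apply: measurable_funPTI; apply: measurableC; exact: measurable_itv.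
- move=> w dxy; apply: contrapT => nN.
  have in01 b : (delta (if b then x else y) @^-1` `]0, 1[) w.
    by apply: contrapT => h; apply: nN; exists b.
  have := in01 true; have := in01 false; rewrite /= !in_itv /= => /andP[y0 y1] /andP[x0 x1].
  have : pri w x <= pri w y by apply: dxy; rewrite /= inE !leqnn; lia.
  rewrite /pri /priority -/(info R X x) -/(info R X y) -/(tier R X x) -/(tier R X y).
  have : (tier R X x)%:~R + 1 <= (tier R X y)%:~R :> R.
    by rewrite -[1]/(1%:~R) -intrD ler_int lezD1.
  by move: x0 x1 y0 y1; clear; lra.
- by rewrite big1 // => b _; rewrite /N uniform01_outside.
Qed.

Lemma prob_tops_interval_rank x y (S : {set 'I_n}) : y \notin S ->
  S \subset between x y -> (forall z, z \in S -> tier R X z = tier R X y) ->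
  fine (P (tops_interval x y)) <= 12 / #|S|.+1%:R.
Proof.
move=> yS Sxy St; apply: le_trans (prob_exceeds udelta idelta yS).
apply: fine_le; rewrite ?fin_num_measure //.
- exact: measurable_tops_interval.
- exact: measurable_exceeds.
apply: le_measure; rewrite ?inE //.
- exact: measurable_tops_interval.
- exact: measurable_exceeds.
move=> w dxy z zS; have /= := dxy z (fintype.subsetP Sxy z zS).
rewrite /pri /priority -/(info R X z) -/(info R X y) -/(tier R X z) -/(tier R X y).
by rewrite St // lerD2l.
Qed.

Let p x y : R := fine (P (tops_interval x y)).

Let p_le1 x y : p x y <= 1.
Proof.
by rewrite -lee_fin fineK ?fin_num_measure ?probability_le1 //; exact: measurable_tops_interval.
Qed.

(** On one side of [x], the items of tier [k] nearer to [x] than [y] all lie between [x] and [y], so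
    the rank of [y] by distance bounds its probability. With at most [2 ^ 2 ^ k.+1] ranks the
    harmonic sum is at most [2 ^ k.+1 + 1], and the two sides turn 12 into 24. *)
Lemma tier_sum (x : 'I_n) (k : nat) :
  \sum_(y | tier R X y == k%:Z) p x y <= 24 * (2 ^ k.+1).+1%:R.
Proof.
rewrite (bigID (fun y : 'I_n => (y <= x)%N)) /=.
have side (U : {set 'I_n}) (f : 'I_n -> nat) :
    (forall y, y \in U -> tier R X y = k%:Z) -> {in U &, injective f} ->
    (forall y z, y \in U -> z \in U -> (f z < f y)%N -> z \in between x y) ->
    \sum_(y in U) p x y <= 12 * (2 ^ k.+1).+1%:R.
  move=> Uk fi Ub.
  apply: (@le_trans _ _ (12 * \sum_(y in U) (#|[set z in U | (f z < f y)%N]%SET|.+1%:R^-1))).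
    rewrite mulr_sumr; apply: ler_sum => y yU; apply: prob_tops_interval_rank.
    - by rewrite inE ltnn andbF.
    - by apply/fintype.subsetP => z; rewrite inE => /andP[zU]; exact: Ub.
    - by move=> z; rewrite inE => /andP[zU _]; rewrite !Uk.
  rewrite rank_sum // ler_pM2l //; apply: harmonic_pow2.
  exact: card_tier Uk.
rewrite (_ : 24 * _ = 12 * (2 ^ k.+1).+1%:R + 12 * (2 ^ k.+1).+1%:R); last first.
  by rewrite -mulrDl -natrD.
apply: lerD.
  rewrite (eq_bigl (fun y => y \in [set y : 'I_n | (tier R X y == k%:Z) && (y <= x)%N]%SET)) => [|y];
    last by rewrite inE.
  (* Rank by distance: [x - y] is injective here, as [y <= x] avoids truncation; right of [x] the
     key itself serves. *)
  apply: (side _ (fun y => x - y)%N).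
  - by move=> y; rewrite inE => /andP[/eqP].
  - move=> y z; rewrite !inE => /andP[_ yx] /andP[_ zx] /= h; apply: val_inj => /=.
    by move: h yx zx; clear; lia.
  - move=> y z; rewrite !inE => /andP[_ yx] /andP[_ zx].
    by move: yx zx; clear; lia.
rewrite (eq_bigl (fun y => y \in [set y : 'I_n | (tier R X y == k%:Z) && ~~ (y <= x)%N]%SET)) => [|y];
  last by rewrite inE.
apply: (side _ (fun y : 'I_n => y : nat)).
- by move=> y; rewrite inE => /andP[/eqP].
- by move=> y z _ _ /val_inj.
- move=> y z; rewrite !inE => /andP[_ yx] /andP[_ zx].
  by move: yx zx; clear; lia.
Qed.

(** The 1 pays for [x] itself if [info R X x < 1], and otherwise for the at most one item of
    negative tier. Tiers above that of [x] contribute nothing; those from 0 to [K] sum to at most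
    [144 * 2 ^+ K <= 144 * info R X x]. *)
Lemma sum_prob_tops_interval x : \sum_y p x y <= 1 + 144 * info R X x.
Proof.
have [Llt|Lge] := ltP (info R X x) 1.
  rewrite (bigD1 x) //= big1 ?addr0 => [|y yx]; last first.
    by rewrite /p prob_tops_interval_lower // dominant_tier.
  by apply: le_trans (p_le1 x x) _; rewrite lerDl mulr_ge0 // info_ge0.
have [K KE] := tier_nat Lge.
apply: (@le_trans _ _ (\sum_y ((tier R X y < 0)%R%:R +
    \sum_(k < K.+1) (if tier R X y == k%:Z then p x y else 0)))).
  apply: ler_sum => y _; have [ty|ty] := ltP (tier R X y) 0.
    by apply: le_trans (p_le1 x y) _; rewrite lerDl sumr_ge0 // => k _; case: ifP => // _; exact: fine_ge0.
  have [tyx|tyx] := leP (tier R X y) (tier R X x); last first.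
    rewrite /p prob_tops_interval_lower // add0r sumr_ge0 // => k _.
    by case: ifP => // _.
  case E: (tier R X y) ty tyx => [k|//] _; rewrite KE lez_nat -ltnS => kK.
  by rewrite add0r (bigD1 (Ordinal kK)) //= eqxx lerDl sumr_ge0 // => i _;
    case: ifP => // _; exact: fine_ge0.
rewrite big_split /=; apply: lerD.
  rewrite -natr_sum (_ : 1 = 1%:R) // ler_nat; apply: leq_trans (card_neg_tier R f1).
  by rewrite -sum1dep_card [leqRHS]big_mkcond; apply: leq_sum => y _; case: (_ < _).
rewrite exchange_big /=; apply: (@le_trans _ _ (\sum_(k < K.+1) 24 * (2 ^ k.+1).+1%:R)).
  by apply: ler_sum => k _; rewrite -big_mkcond; exact: tier_sum.
apply: le_trans (harmonic_tiers R K) _; rewrite ler_pM2l //.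
exact: info_tier.
Qed.

(** The weights cover both uses: an indicator gives the depth of one item, the frequencies give the
    access cost. *)
Lemma expectation_depth_sum (c : 'I_n -> R) (f : Omega -> R) :
  (forall x, 0 <= c x) ->
  (forall w, f w = \sum_x c x * (depth (treap (pri w)) x)%:R) ->
  ('E_P[f] <= (\sum_x c x * (1 + 144 * info R X x))%:E)%E.
Proof.
move=> c0 fE.
have L1 x y : (\1_(tops_interval x y) : Omega -> R) \in Lfun P 1.
  by apply: Lfun1_indic; exact: measurable_tops_interval.
have L2 x : (fun w => \sum_y (\1_(tops_interval x y) w : R)) \in Lfun P 1.
  by apply: Lfun1_bigsum.
pose g x w : R := (c x \o* (fun w => \sum_y (\1_(tops_interval x y) w : R))) w.
apply: (@le_trans _ _ ('E_P[fun w => (\sum_x g x w)%R])%E).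
  apply: le_expectation_ge0 => w.
    by rewrite fE sumr_ge0 // => x _; rewrite mulr_ge0.
  rewrite fE; apply: ler_sum => x _; rewrite /g /= [leRHS]mulrC.
  by apply: ler_wpM2l => //; exact: depth_treap_le.
rewrite expectation_bigsum => [|x _]; last by apply: Lfun_scale.
rewrite -sumEFin; apply: lee_sum => x _; rewrite expectationZl // EFinM.
rewrite lee_wpmul2l ?lee_fin // expectation_bigsum //.
rewrite (eq_bigr (fun y => (p x y)%:E)) => [|y _].
  by rewrite sumEFin lee_fin sum_prob_tops_interval.
by rewrite expectation_indic ?fineK ?fin_num_measure //; exact: measurable_tops_interval.
Qed.

End treap_depth.

(* Expected access time against the optimal tree *)
Local Close Scope classical_set_scope.

(* Both logarithmic bounds carry the additive contribution of the accessed node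
   itself, which depth counts: log2 (m / freq) tends to 0 as freq approaches m,
   whereas every depth is at least 1. *)
Theorem mainTheorem2 (R : realType) :
  exists C : R, 0 < C /\
  forall (n m : nat) (X : m.-tuple 'I_n),
  (forall x : 'I_n, (1 <= freq X x)%N) ->
  forall (d : measure_display) (Omega : measurableType d)
    (P : probability Omega R) (delta : 'I_n -> {RV P >-> R}),
  (forall x : 'I_n, uniform01 (delta x)) ->
  kwise_independent 11 delta ->
  let T (w : Omega) : tree n := treap (priority X (fun x => delta x w)) in
  let total_time : \bar R := ('E_P[fun w => (access_cost (T w) X)%:R])%E in
  let entropy : R :=
    \sum_(x < n) (freq X x)%:R * log2 (m%:R / (freq X x)%:R) in
  [/\ forall x : 'I_n,
        ('E_P[fun w => (depth (T w) x)%:R] <=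
          (1 + C * log2 (m%:R / (freq X x)%:R))%:E)%E,
      (total_time <= (m%:R + C * entropy)%:E)%E
    & forall Topt : tree n, is_optimal_bst X Topt ->
        let opt : R := (access_cost Topt X)%:R in
        [/\ opt <= C * (m%:R + entropy),
            m%:R + entropy <= C * opt,
            (opt%:E <= total_time)%E
          & (total_time <= (C * opt)%:E)%E]].
Proof.
(* [289 = 1 + 2 * 144]: the total is at most [m + 144 * entropy], with [m <= opt] and
   [entropy <= 2 * opt]. *)
exists 289; split; first by rewrite ltr0n.
move=> n m X f1 d Omega P delta udelta idelta T total_time entropy.
have idelta5 := kwise_independentW (isT : (5 <= 11)%N) idelta.
have info0 x : 0 <= info R X x by exact: info_ge0.
have entropy0 : 0 <= entropy.
  by apply: sumr_ge0 => x _; apply: mulr_ge0 => //; exact: info0.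
have depth_le x :
    ('E_P[fun w => (depth (T w) x)%:R] <= (1 + 144 * info R X x)%:E)%E.
  have sum_at (F : 'I_n -> R) : \sum_z (z == x)%:R * F z = F x.
    by rewrite (bigD1 x) //= eqxx mul1r big1 ?addr0 // => z /negbTE ->; rewrite mul0r.
  rewrite -(sum_at (fun z => 1 + 144 * info R X z)).
  by apply: (expectation_depth_sum f1 udelta idelta5).
have total_le : (total_time <= (m%:R + 144 * entropy)%:E)%E.
  rewrite (_ : m%:R + 144 * entropy =
      \sum_x (freq X x)%:R * (1 + 144 * info R X x)).
    apply: (expectation_depth_sum f1 udelta idelta5) => // w.
    exact: access_costE.
  rewrite (eq_bigr (fun x => (freq X x)%:R + 144 * ((freq X x)%:R * info R X x))).
    by rewrite big_split /= -natr_sum sum_freq -mulr_sumr.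
  by move=> x _; rewrite mulrDr mulr1 mulrCA.
split.
- move=> x; apply: le_trans (depth_le x) _; rewrite lee_fin lerD2l.
  by apply: ler_wpM2r; [exact: info0|rewrite ler_nat].
- apply: le_trans total_le _; rewrite lee_fin lerD2l.
  by apply: ler_wpM2r => //; rewrite ler_nat.
move=> Topt [bopt minopt] opt.
have m_opt : m%:R <= opt.
  rewrite /opt ler_nat -[leqLHS]card_ord -sum1_card; apply: leq_sum => i _.
  by apply: depth_gt0; exact: bopt.2.
have ent_opt : entropy <= 2 * opt by exact: entropy_le_cost.
(* Each outcome of the treap is a search tree, so its cost is pointwise at least the constant
   [opt]. *)
have opt_le : (opt%:E <= total_time)%E.
  rewrite -(expectation_cst P opt); apply: le_expectation_ge0 => w //=.
  by rewrite ler_nat minopt //; case: (treap_is_treap (priority X (fun x => delta x w))).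
have := le_trans opt_le total_le.
rewrite lee_fin => opt_ent; split=> //.
- by move: entropy0 opt_ent (ler0n R m); clear; lra.
- by move: m_opt ent_opt (ler0n R m); clear; lra.
apply: le_trans total_le _; rewrite lee_fin.
by move: m_opt ent_opt (ler0n R m); clear; lra.
Qed.
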